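(* Consider the matrix $A_N:=\mathcal{C}_n(\mathbf{f})$, where $\mathbf{f}$ is a $d\times d$ matrix-valued trigonometric polynomial of degree $1$, with $\mathbf{f}\ge 0$. Assume $$\mathbf{f}(\theta)=\hat{\mathbf{f}}_0+\hat{\mathbf{f}}_{-1}e^{-\mathbf{i}\theta}+\hat{\mathbf{f}}_{1}e^{\mathbf{i}\theta},$$ with $$\hat{\mathbf{f}}_{-1}=uv^T,\qquad \hat{\mathbf{f}}_1=(\hat{\mathbf{f}}_{-1})^T=vu^T,\qquad u,v\in\mathbb{C}^d.$$ Then $$\left\|\hat{\mathbf{f}}_0^{-\frac12}\,\mathbf{f}\,\hat{\mathbf{f}}_0^{-\frac12}\right\|_\infty=1+\max_\theta\left(z^Tw\cos\theta+\sqrt{(z^Tw)^2(\cos^2\theta-1)+\|w\|^2\|z\|^2}\right),$$ with $w=\hat{\mathbf{f}}_0^{-\frac12}u$ and $z=\hat{\mathbf{f}}_0^{-\frac12}v$.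
   Context: Here $\mathbf{i}^2=-1$, $^T$ denotes transposition (without conjugation), and $\mathbf{f}\ge 0$ means that $\mathbf{f}(\theta)$ is Hermitian positive semidefinite for all $\theta$. The $d\times d$ matrices $\hat{\mathbf{f}}_j=\frac{1}{2\pi}\int_{-\pi}^{\pi}\mathbf{f}(\theta)e^{-\mathbf{i}j\theta}\,d\theta$ are the Fourier coefficients of $\mathbf{f}$, and $\hat{\mathbf{f}}_0^{-\frac12}$ is the inverse of the Hermitian positive semidefinite square root of $\hat{\mathbf{f}}_0$. The matrix $\mathcal{C}_n(\mathbf{f})$ is the block-circulant matrix of order $N=dn$ generated by $\mathbf{f}$, i.e. $\mathcal{C}_n(\mathbf{f})=(F_n\otimes I_d)\,\mathrm{diag}_{i=0,\dots,n-1}\big(\mathbf{f}(\theta_i^{(n)})\big)(F_n^H\otimes I_d)$ with $\theta_i^{(n)}=2\pi i/n$ (here $i$ is an index), $I_d$ the identity matrix of size $d$, and $F_n=\frac{1}{\sqrt n}\big[e^{-\mathbf{i}j\theta_k^{(n)}}\big]_{j,k=0}^{n-1}$ the unitary Fourier matrix. For a matrix-valued function $\mathbf{g}$, $\|\mathbf{g}\|_\infty=\mathrm{ess\,sup}_{\theta\in(-\pi,\pi)}\|\mathbf{g}(\theta)\|_2$, where $\|\cdot\|_2$ is the matrix norm induced by the Euclidean norm; on vectors, $\|\cdot\|$ is the Euclidean norm.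
   Formalization: The zeroth Fourier coefficient of f is additionally assumed symmetric under transposition (without this the formula fails for some complex Hermitian coefficients) and invertible, so that its inverse square root exists. *)

(* Defs.v *)
From HB Require Import structures.
From mathcomp Require Import all_boot all_order all_algebra.
From mathcomp Require Import all_classical all_reals all_analysis.
From mathcomp Require Import ess_sup_inf complex mxtens.
Set Implicit Arguments.
Unset Strict Implicit.
Unset Printing Implicit Defensive.
Import Order.TTheory GRing.Theory Num.Theory.
Import numFieldNormedType.Exports.
Local Open Scope classical_set_scope.
Local Open Scope ring_scope.
Local Open Scope sesquilinear_scope.

Section Definitions.
Variable R : realType.
Local Notation C := (R[i]).

Definition expi (t : R) : C := Complex (cos t) (sin t).

Definition psdmx (d : nat) (A : 'M[C]_d) : Prop :=
  A \is hermsymmx /\ forall x : 'cV[C]_d, 0 <= (x^t* *m A *m x) 0 0.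

(* The positive semidefinite square root; it exists and is unique as soon as
   [A] is positive semidefinite, and is the default [0] when there is none. *)
Definition sqrtmx (d : nat) (A : 'M[C]_d) : 'M[C]_d :=
  xget 0 [set S : 'M[C]_d | psdmx S /\ S *m S = A].

Definition inv_sqrtmx (d : nat) (A : 'M[C]_d) : 'M[C]_d := invmx (sqrtmx A).

Definition norm2 (d : nat) (x : 'cV[C]_d) : R :=
  Num.sqrt (\sum_(i < d) Normc.normc (x i 0) ^+ 2).

Definition mxnorm2 (d : nat) (A : 'M[C]_d) : R :=
  sup [set norm2 (A *m x) | x in [set x : 'cV[C]_d | norm2 x <= 1]].

Definition norm_oo (d : nat) (g : R -> 'M[C]_d) : \bar R :=
  ess_sup (mrestr (@lebesgue_measure R) (measurable_itv `](- pi : R), pi[))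
    (fun t => (mxnorm2 (g t))%:E).

Definition cintegral (D : set R) (h : R -> C) : C :=
  Complex (\int[@lebesgue_measure R]_(t in D) complex.Re (h t))
          (\int[@lebesgue_measure R]_(t in D) complex.Im (h t)).

Definition fourier_coef (d : nat) (f : R -> 'M[C]_d) (j : int) : 'M[C]_d :=
  \matrix_(a, b) (((2 * pi)^-1)%:C%C *
    cintegral `[- pi, pi] (fun t => f t a b * expi (- (j%:~R * t)))).

Definition grid (n k : nat) : R := 2 * pi * k%:R / n%:R.

Definition fourier_mx (n : nat) : 'M[C]_n :=
  \matrix_(j, k) (((Num.sqrt n%:R)^-1)%:C%C * expi (- (j%:R * grid n k))).

(* The sum over [k] is the block-diagonal matrix with blocks [f (grid n k)]. *)
Definition block_circulant (d n : nat) (f : R -> 'M[C]_d) : 'M[C]_(n * d) :=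
  (fourier_mx n *t 1%:M)
    *m (\sum_(k < n) delta_mx k k *t f (grid n k))
    *m ((fourier_mx n)^t* *t 1%:M).

(* The order of [C] compares only numbers that differ by a real, so a maximum
   in this sense entails that all the values of [h] are real. *)
Definition is_max (h : R -> C) (m : R) : Prop :=
  (exists t, h t = m%:C%C) /\ forall t, h t <= m%:C%C.

End Definitions.

(* Main.v *)
Require Import Defs.
From HB Require Import structures.
From mathcomp Require Import all_boot all_order all_algebra.
From mathcomp Require Import all_classical all_reals all_analysis.
From mathcomp Require Import ess_sup_inf complex mxtens ring lra.
Set Implicit Arguments.
Unset Strict Implicit.
Unset Printing Implicit Defensive.
Import Order.TTheory GRing.Theory Num.Theory.
Import numFieldNormedType.Exports.
Local Open Scope classical_set_scope.
Local Open Scope ring_scope.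
Local Open Scope sesquilinear_scope.

(** Write B for the inverse square root of the mean coefficient F0. A positive
semidefinite symbol is Hermitian at every angle, and comparing its Fourier
coefficients ([symbol_coefs]) gives two things: F0 is positive semidefinite, and
the adjoint of u v^T is its transpose v u^T, that is, u v^T is real. Because F0
is Hermitian and symmetric, so is B; this uses that a positive definite matrix
has only one positive semidefinite square root ([psdmx_sqrt_unique],
[inv_sqrtmxP]). Hence, with q the entrywise conjugate of z,

  B f(t) B = I + M(t),   M(t) = e^(-it) w q^* + e^(it) q w^*,

and c = q^* w = z^T w is a real number.

As a function of t the claimed expression c cos t + sqrt(c^2 (cos^2 t - 1) + K^2),
where K = ||w|| ||z|| >= |c|, is largest where cos t is the sign of c, since both
summands are; its maximum is m = |c| + K ([is_max_rank2_eigenvalue]). It remains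
to show that the essential supremum of the norms is 1 + m.

- Upper bound. M(t) is p q^* + q p^* with p = e^(-it) w, and such a matrix has
  norm at most ||p|| ||q|| + |q^* p| = m ([norm2_hermitian_rank2_le]).
- Lower bound. Let s be the sign of c. The vector x = ||q|| w + s ||w|| q is an
  eigenvector of M(t) for the eigenvalue m when cos t = s, and for every t its
  Rayleigh quotient for I + M(t) is 1 + m s cos t ([rayleigh_symbol]). This
  continuous lower bound reaches 1 + m at t = 0 or at t = pi, and a value reached
  at a point of the closed interval is at most the essential supremum over the
  open one ([ess_sup_itv_ge]).

The argument compares suprema and not the values at each angle: when d = 1 the
norm of I + M(t) can be smaller than 1 plus the displayed expression, because
M(t) then has only one eigenvalue. *)

(** * Adjoints and the Hermitian inner product *)

Section Adjoint.
Variable C : numClosedFieldType.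

Lemma adjmxM m n p (A : 'M[C]_(m, n)) (B : 'M[C]_(n, p)) :
  (A *m B)^t* = B^t* *m A^t*.
Proof. by rewrite trmx_mul map_mxM. Qed.

Lemma adjmxD m n (A B : 'M[C]_(m, n)) : (A + B)^t* = A^t* + B^t*.
Proof. by rewrite linearD /= map_mxD. Qed.

Lemma adjmxZ m n a (A : 'M[C]_(m, n)) : (a *: A)^t* = a^* *: A^t*.
Proof. by rewrite linearZ /= map_mxZ. Qed.

Lemma hermsymmxP n (A : 'M[C]_n) : reflect (A^t* = A) (A \is hermsymmx).
Proof.
by apply: (iffP (is_hermitianmxP _ _ _)); rewrite expr0 scale1r => /esym.
Qed.

End Adjoint.

Section RealEmbedding.
Variable R : rcfType.
Implicit Types (r s : R).

(** The embedding of the reals is a convertible alias of its morphism instance;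
these instances of the morphism laws keep the printed form when rewriting. *)
Lemma realcD r s : (r + s)%:C%C = r%:C%C + s%:C%C :> R[i].
Proof. exact: rmorphD. Qed.

Lemma realcB r s : (r - s)%:C%C = r%:C%C - s%:C%C :> R[i].
Proof. exact: rmorphB. Qed.

Lemma realcM r s : (r * s)%:C%C = r%:C%C * s%:C%C :> R[i].
Proof. exact: rmorphM. Qed.

Lemma realcX r n : (r ^+ n)%:C%C = r%:C%C ^+ n :> R[i].
Proof. exact: rmorphXn. Qed.

Lemma normcC (a : R[i]) : (Normc.normc a)%:C%C = `|a|.
Proof. by case: a. Qed.

Lemma normc_ge0 (a : R[i]) : 0 <= Normc.normc a.
Proof. by case: a => ? ?; exact: sqrtr_ge0. Qed.

Lemma real2ReC (a : R[i]) : (2 * complex.Re a)%:C%C = a + a^*%R.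
Proof. by rewrite realcM rmorph_nat -addcJ. Qed.

Lemma le_Re_normc (a : R[i]) : complex.Re a <= Normc.normc a.
Proof.
rewrite -lecR normcC; apply: le_trans (normc_ge_Re a).
by rewrite lecR ler_norm.
Qed.

Lemma normc_conj (a : R[i]) : Normc.normc a^*%R = Normc.normc a.
Proof. by apply: complexI; rewrite !normcC norm_conjC. Qed.

Lemma sqrtC_real (r : R) : 0 <= r -> sqrtC r%:C%C = (Num.sqrt r)%:C%C :> R[i].
Proof.
by move=> r0; rewrite -{1}(sqr_sqrtr r0) realcX sqrCK // lecR sqrtr_ge0.
Qed.

End RealEmbedding.

Section Dot.
Variables (R : realType) (d : nat).
Local Notation C := (R[i]).
Implicit Types (x y z : 'cV[C]_d) (a b : C).

Definition dot x y : C := (x^t* *m y) 0 0.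

Lemma dotC x y : dot y x = (dot x y)^*%R.
Proof.
rewrite /dot !mxE rmorph_sum; apply: eq_bigr => i _.
by rewrite !mxE rmorphM /= conjCK mulrC.
Qed.

Lemma dotDr x y z : dot x (y + z) = dot x y + dot x z.
Proof. by rewrite /dot mulmxDr mxE. Qed.

Lemma dotZr a x y : dot x (a *: y) = a * dot x y.
Proof. by rewrite /dot -scalemxAr mxE. Qed.

Lemma dotDl x y z : dot (x + y) z = dot x z + dot y z.
Proof. by rewrite dotC dotDr rmorphD /= -!dotC. Qed.

Lemma dotZl a x y : dot (a *: x) y = a^*%R * dot x y.
Proof. by rewrite dotC dotZr rmorphM /= -dotC. Qed.

Lemma dotxx x : dot x x = (norm2 x ^+ 2)%:C%C.
Proof.
rewrite /dot /norm2 sqr_sqrtr; last by apply: sumr_ge0 => i _; exact: sqr_ge0.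
rewrite mxE rmorph_sum; apply: eq_bigr => i _.
by rewrite !mxE mulrC -sqr_normc rmorphXn /=; congr (_ ^+ 2).
Qed.

Lemma norm2_ge0 x : 0 <= norm2 x.
Proof. exact: sqrtr_ge0. Qed.

Lemma norm2_eq0 x : (norm2 x == 0) = (x == 0).
Proof.
apply/eqP/eqP => [x0|->]; last first.
  by rewrite /norm2 big1 ?sqrtr0 // => i _; rewrite mxE Normc.normc0 expr0n.
apply/matrixP => i j; rewrite ord1 mxE.
move/eqP: x0; rewrite sqrtr_eq0 => le0.
have : Normc.normc (x i 0) ^+ 2 <= 0.
  apply: le_trans le0; rewrite (bigD1 i) //= lerDl.
  by apply: sumr_ge0 => k _; exact: sqr_ge0.
move=> h; apply: Normc.eq0_normc; apply/eqP; rewrite -sqrf_eq0.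
by rewrite eq_le h sqr_ge0.
Qed.

Lemma norm2Z a x : norm2 (a *: x) = Normc.normc a * norm2 x.
Proof.
apply/eqP; rewrite -(eqrXn2 (n := 2)) ?mulr_ge0 ?normc_ge0 ?norm2_ge0 //.
apply/eqP/complexI; rewrite -dotxx dotZl dotZr dotxx exprMn [in RHS]realcM.
by rewrite [in RHS]realcX normcC normCK mulrA [_ * a]mulrC.
Qed.

Lemma normc_dot_le x y : Normc.normc (dot x y) <= norm2 x * norm2 y.
Proof.
rewrite -(ler_pXn2r (n := 2)) ?nnegrE ?normc_ge0 ?mulr_ge0 ?norm2_ge0 //.
rewrite exprMn -lecR realcX normcC [X in _ <= X]realcM -!dotxx.
have : `|dotmx (x^t*) (y^t*)| ^+ 2
    <= dotmx (x^t*) (x^t*) * dotmx (y^t*) (y^t*).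
  exact: (CauchySchwarz (@dotmx C d) (x^t*) (y^t*)).1.
by rewrite !dotmxE !trmxCK.
Qed.

Lemma norm2D_sqr x y :
  norm2 (x + y) ^+ 2 = norm2 x ^+ 2 + norm2 y ^+ 2 + 2 * complex.Re (dot x y).
Proof.
apply: complexI; rewrite -dotxx dotDl !dotDr [dot y x]dotC.
rewrite !realcD -!dotxx real2ReC -!addrA; congr (_ + _).
by rewrite addrA addrC.
Qed.

Lemma norm2D x y : norm2 (x + y) <= norm2 x + norm2 y.
Proof.
rewrite -(ler_pXn2r (n := 2)) ?nnegrE ?addr_ge0 ?norm2_ge0 //.
rewrite norm2D_sqr.
have := le_trans (le_Re_normc _) (normc_dot_le x y); nra.
Qed.

Lemma norm2_conj x : norm2 (map_mx Num.conj x) = norm2 x.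
Proof.
congr Num.sqrt; apply: eq_bigr => i _.
by rewrite mxE normc_conj.
Qed.

Lemma rank1E x y z : x *m y^t* *m z = dot y z *: x.
Proof. by rewrite -mulmxA [y^t* *m z]mx11_scalar mul_mx_scalar. Qed.

Lemma norm2_comb_sqr a b x y :
  norm2 (a *: x + b *: y) ^+ 2 <=
    (Normc.normc a * norm2 x) ^+ 2 + (Normc.normc b * norm2 y) ^+ 2
    + 2 * (Normc.normc a * Normc.normc b * Normc.normc (dot x y)).
Proof.
rewrite norm2D_sqr !norm2Z lerD2l ler_pM2l // dotZl dotZr.
apply: le_trans (le_Re_normc _) _.
by rewrite !Normc.normcM normc_conj mulrA.
Qed.

Lemma dot0r x : dot x 0 = 0.
Proof. by rewrite /dot mulmx0 mxE. Qed.

Lemma dot0l x : dot 0 x = 0.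
Proof. by rewrite dotC dot0r conjC0. Qed.

Lemma norm20 : norm2 (0 : 'cV[C]_d) = 0.
Proof. by apply/eqP; rewrite norm2_eq0. Qed.

(** The matrix M = p q^* + q p^* maps x to V J V^* x, where V has columns p and q
and J swaps the two coordinates, so its norm is controlled by the Gram matrix of
p and q. Rescaling p and q to a common length does not change M but would cost
divisions; instead the coordinates a = |q^* x| and b = |p^* x| are weighted by
the opposite lengths, T = a^2 P^2 + b^2 Q^2, with P = ||p|| and Q = ||q||. The
arithmetic-geometric mean inequality gives P Q ||M x||^2 <= (P Q + |q^* p|) T,
and Cauchy-Schwarz gives T <= P Q (P Q + |q^* p|) ||x||^2. *)
Lemma norm2_hermitian_rank2_le p q x :
  norm2 (dot q x *: p + dot p x *: q) <=
    (norm2 p * norm2 q + Normc.normc (dot q p)) * norm2 x.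
Proof.
have B0 u v : 0 <= (norm2 u * norm2 v + Normc.normc (dot v u)) * norm2 x.
  by rewrite mulr_ge0 ?addr_ge0 ?mulr_ge0 ?norm2_ge0 ?normc_ge0.
have [p0|p0] := eqVneq p 0.
  by rewrite p0 dot0l scaler0 scale0r addr0 {1}norm20; exact: B0.
have [q0|q0] := eqVneq q 0.
  by rewrite q0 dot0l scaler0 scale0r addr0 {1}norm20; exact: B0.
rewrite -(ler_pXn2r (n := 2)) ?nnegrE ?norm2_ge0 //.
set P := norm2 p; set Q := norm2 q; set c := Normc.normc (dot q p).
set X := norm2 x.
set a := Normc.normc (dot q x); set b := Normc.normc (dot p x).
have P0 : 0 < P by rewrite lt_def norm2_eq0 p0 norm2_ge0.
have Q0 : 0 < Q by rewrite lt_def norm2_eq0 q0 norm2_ge0.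
have [P0' Q0'] := (ltW P0, ltW Q0).
have [a0 b0 c0] : [/\ 0 <= a, 0 <= b & 0 <= c] by rewrite !normc_ge0.
have X0 : 0 <= X by exact: norm2_ge0.
have cE : Normc.normc (dot p q) = c by rewrite dotC normc_conj.
set L := norm2 (_ + _).
have L2 : L ^+ 2 <= (a * P) ^+ 2 + (b * Q) ^+ 2 + 2 * (a * b * c).
  by rewrite -cE norm2_comb_sqr.
set T := (a * P) ^+ 2 + (b * Q) ^+ 2.
(* This vector is chosen for x^* y = T, so that Cauchy-Schwarz bounds T. *)
set y := ((P ^+ 2)%:C%C * dot q x) *: q + ((Q ^+ 2)%:C%C * dot p x) *: p.
have normcR (r : R) : 0 <= r -> Normc.normc (r%:C%C) = r.
  by move=> r0; apply: complexI; rewrite normcC ger0_norm // lecR.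
have normcJ v : (v * v^*%R : C) = (Normc.normc v ^+ 2)%:C%C.
  by rewrite realcX normcC normCK.
have Txy : dot x y = T%:C%C.
  rewrite dotDr !dotZr [dot x q]dotC [dot x p]dotC -!mulrA !normcJ.
  by rewrite -!realcM -realcD /T !exprMn; congr (_%:C%C); rewrite /a /b; ring.
have T0 : 0 <= T by rewrite addr_ge0 ?sqr_ge0.
have Ty : T <= X * norm2 y.
  by have := normc_dot_le x y; rewrite Txy normcR //.
have Y0 : 0 <= norm2 y by exact: norm2_ge0.
have Y2 : norm2 y ^+ 2 <= (P * Q) * (P * Q + c) * T.
  apply: le_trans (norm2_comb_sqr _ _ _ _) _.
  rewrite !Normc.normcM !normcR ?sqr_ge0 // -/P -/Q -/a -/b -/c /T.
  have : 0 <= (P * Q) * c * (a * P - b * Q) ^+ 2.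
    by apply: mulr_ge0 (sqr_ge0 _); rewrite !mulr_ge0.
  lra.
have K0 : 0 < P * Q by exact: mulr_gt0.
have T2 : T <= X ^+ 2 * (P * Q) * (P * Q + c).
  have [->|Tn0] := eqVneq T 0.
    by rewrite !mulr_ge0 ?sqr_ge0 ?addr_ge0 ?mulr_ge0.
  have Tp : 0 < T by rewrite lt_def Tn0.
  rewrite -(ler_pM2r Tp).
  have : T ^+ 2 <= (X * norm2 y) ^+ 2.
    by rewrite ler_pXn2r ?nnegrE // mulr_ge0.
  have : X ^+ 2 * norm2 y ^+ 2 <= X ^+ 2 * (P * Q * (P * Q + c) * T).
    by rewrite ler_wpM2l ?sqr_ge0.
  rewrite exprMn; lra.
have L3 : (P * Q) * L ^+ 2 <= (P * Q + c) * T.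
  have : P * Q * L ^+ 2 <= P * Q * (T + 2 * (a * b * c)) by rewrite ler_pM2l.
  have : 0 <= c * (a * P - b * Q) ^+ 2 by rewrite mulr_ge0 ?sqr_ge0.
  rewrite /T; lra.
rewrite -(ler_pM2l K0) (le_trans L3) // exprMn.
have : (P * Q + c) * T <= (P * Q + c) * (X ^+ 2 * (P * Q) * (P * Q + c)).
  by rewrite ler_wpM2l // addr_ge0 // mulr_ge0.
lra.
Qed.

End Dot.

(** * Square roots of positive semidefinite matrices *)

Section PsdRoot.
Variables (R : realType) (d : nat).
Local Notation C := (R[i]).
Implicit Types (A S T D : 'M[C]_d).

Lemma psdmx_adj A : psdmx A -> A^t* = A.
Proof. by case=> /hermsymmxP. Qed.

Lemma dot_adjmx A (x y : 'cV[C]_d) : dot (A *m x) y = dot x (A^t* *m y).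
Proof. by rewrite /dot adjmxM mulmxA. Qed.

Lemma psdmxP A : A^t* = A -> (forall x, 0 <= dot x (A *m x)) -> psdmx A.
Proof.
by move=> hA pA; split; [exact/hermsymmxP | move=> x; rewrite -mulmxA; exact: pA].
Qed.

Lemma psdmx_dot_ge0 A x : psdmx A -> 0 <= dot x (A *m x).
Proof. by case=> _ /(_ x); rewrite -mulmxA. Qed.

(** In an orthonormal eigenbasis A is diagonal with nonnegative entries, whose
square roots give S. *)
Lemma psdmx_sqrt_exists A : psdmx A -> exists S, psdmx S /\ S *m S = A.
Proof.
move=> pA; have [hA _] := pA.
pose P := spectralmx A; pose D := spectral_diag A.
have Pu : P \is unitarymx by exact: spectral_unitarymx.
have PPt : P *m P^t* = 1%:M by exact/unitarymxP.
have AE : A = P^t* *m diag_mx D *m P.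
  by rewrite -invmx_unitary //; exact/orthomx_spectralP/hermitian_normalmx.
have D0 i : 0 <= D 0 i.
  have := psdmx_dot_ge0 (P^t* *m delta_mx i 0) pA.
  rewrite {1}AE dot_adjmx trmxCK !mulmxA PPt mul1mx -[diag_mx D *m P *m _]mulmxA.
  rewrite PPt mulmx1 /dot -map_trmx map_delta_mx trmx_delta -rowE.
  by rewrite -colE !mxE eqxx.
pose E := \row_i sqrtC (D 0 i).
have EE : diag_mx E *m diag_mx E = diag_mx D.
  rewrite mulmx_diag; congr diag_mx; apply/rowP => i.
  by rewrite !mxE -expr2 sqrtCK.
have Eh : (diag_mx E)^t* = diag_mx E.
  rewrite tr_diag_mx map_diag_mx; congr diag_mx; apply/rowP => i.
  by rewrite !mxE; apply: geC0_conj; rewrite sqrtC_ge0.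
exists (P^t* *m diag_mx E *m P); split; last first.
  rewrite !mulmxA -[_ *m P *m P^t*]mulmxA PPt mulmx1.
  by rewrite -[_ *m diag_mx E *m diag_mx E]mulmxA EE -AE.
apply: psdmxP => [|x]; first by rewrite !adjmxM trmxCK Eh mulmxA.
rewrite -!mulmxA -[P^t*]trmxCK trmxCK -dot_adjmx /dot mxE.
apply: sumr_ge0 => i _; rewrite mul_diag_mx !mxE mulrCA mulr_ge0 ?sqrtC_ge0 //.
by rewrite mulrC mul_conjC_ge0.
Qed.

(** With A = S S and S Hermitian, x^* A x is the squared length of S x. *)
Lemma psdmx_kernel A (x : 'cV[C]_d) : psdmx A -> dot x (A *m x) = 0 -> A *m x = 0.
Proof.
move=> /psdmx_sqrt_exists[S [/psdmx_adj hS <-]].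
rewrite -mulmxA -{1}hS -dot_adjmx dotxx => /complexI/eqP.
by rewrite sqrf_eq0 norm2_eq0 => /eqP ->; rewrite mulmx0.
Qed.

Lemma psdmx_congruence A (B : 'M[C]_d) : psdmx A -> psdmx (B^t* *m A *m B).
Proof.
move=> pA; apply: psdmxP => [|x].
  by rewrite !adjmxM trmxCK (psdmx_adj pA) mulmxA.
by rewrite -!mulmxA -dot_adjmx; exact: psdmx_dot_ge0.
Qed.

Lemma psdmx_diag_ge0 A i : psdmx A -> 0 <= A i i.
Proof.
move=> /(psdmx_dot_ge0 (delta_mx i 0)).
by rewrite /dot -map_trmx map_delta_mx trmx_delta -colE -rowE !mxE.
Qed.

(** Put D = S - T. From S S = T T one gets S D = - D T, so the traces of D S D and
of D T D, both nonnegative, are opposite and therefore vanish. Each diagonal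
entry of D S D, which is the quadratic form of S at a column of D, is then zero;
hence S D = 0, and D = 0 as S is invertible. *)
Lemma psdmx_sqrt_unique S T : psdmx S -> psdmx T -> S \in unitmx ->
  S *m S = T *m T -> S = T.
Proof.
move=> pS pT uS eqST; pose D := S - T.
have hD : D^t* = D by rewrite /D linearB map_mxB /= !psdmx_adj.
have SDDT : S *m D = - (D *m T).
  apply/eqP; rewrite -addr_eq0 /D mulmxBr mulmxBl eqST.
  by rewrite addrA subrK subrr.
have /eqP tr0 : \tr (D *m S *m D) == 0.
  rewrite eq_le; apply/andP; split; last first.
    by apply: sumr_ge0 => i _; rewrite -{1}hD; exact/psdmx_diag_ge0/psdmx_congruence.
  rewrite -mulmxA SDDT mulmxN raddfN /= oppr_le0 mulmxA mxtrace_mulC mulmxA.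
  rewrite mxtrace_mulC mulmxA.
  by apply: sumr_ge0 => i _; rewrite -{1}hD; exact/psdmx_diag_ge0/psdmx_congruence.
have diag0 i : (D *m S *m D) i i = 0.
  apply/eqP; move/eqP: tr0; rewrite /mxtrace psumr_eq0.
    by move=> /allP/(_ i); rewrite mem_index_enum => /(_ isT).
  by move=> j _; rewrite -{1}hD; exact/psdmx_diag_ge0/psdmx_congruence.
suff SD0 : S *m D = 0.
  by apply/eqP; rewrite -subr_eq0 -/D -(mulKmx uS D) SD0 mulmx0.
apply/matrixP => j i.
have colSD : S *m col i D = col i (S *m D) by rewrite !colE mulmxA.
have : S *m col i D = 0.
  apply: psdmx_kernel => //; rewrite -(diag0 i) /dot mulmxA.
  have -> : (col i D)^t* = row i D by rewrite -[in RHS]hD; apply/rowP => k; rewrite !mxE.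
  rewrite -!mulmxA colSD [LHS]mxE [RHS]mxE; apply: eq_bigr => k _.
  by rewrite [row i D _ _]mxE [col _ _ _ _]mxE.
by rewrite colSD => /colP/(_ j); rewrite !mxE.
Qed.

Lemma sqrtmxP (A : 'M[C]_d) : psdmx A -> psdmx (sqrtmx A) /\ sqrtmx A *m sqrtmx A = A.
Proof. by move=> /psdmx_sqrt_exists; exact: xgetPex. Qed.

(** The quadratic form of A^T at x is that of A at the conjugate of x. *)
Lemma psdmx_tr (A : 'M[C]_d) : psdmx A -> psdmx A^T.
Proof.
move=> pA; apply: psdmxP => [|x].
  by rewrite -{2}(psdmx_adj pA) map_trmx.
have -> : dot x (A^T *m x) = dot (map_mx Num.conj x) (A *m map_mx Num.conj x).
  rewrite /dot [LHS](_ : _ = ((x^t* *m (A^T *m x))^T) 0 0); last by rewrite [RHS]mxE.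
  rewrite !trmx_mul trmxK -map_trmx trmxK -mulmxA -map_trmx.
  by rewrite map_mxCK.
exact: psdmx_dot_ge0.
Qed.

(** For symmetric A the transpose of the square root is again a positive
semidefinite square root of A, so by uniqueness the root is symmetric. *)
Lemma inv_sqrtmxP (A : 'M[C]_d) (B := inv_sqrtmx A) :
  psdmx A -> A \in unitmx -> A^T = A ->
  [/\ B^t* = B, B^T = B & B *m A *m B = 1%:M].
Proof.
move=> pA uA sA; have [pS SS] := sqrtmxP pA.
have uS : sqrtmx A \in unitmx by move: uA; rewrite -{1}SS unitmx_mul andbb.
have hS := psdmx_adj pS.
have tS : (sqrtmx A)^T = sqrtmx A.
  apply/esym/psdmx_sqrt_unique => //; first exact: psdmx_tr.
  by rewrite -trmx_mul SS sA.
rewrite /B /inv_sqrtmx; split; first by rewrite trmx_inv map_invmx hS.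
  by rewrite trmx_inv tS.
by rewrite -{2}SS mulmxA mulVmx // mul1mx mulmxV.
Qed.

End PsdRoot.

(** * Spectral norm and essential supremum *)

Section Norms.
Variable R : realType.
Local Notation C := (R[i]).

(** A number below h t0 is exceeded by h on a neighbourhood of t0, which meets the
open interval in a set of positive measure even when t0 is an endpoint. *)
Lemma ess_sup_itv_ge (a b t0 : R) (g h : R -> R) : a < b -> a <= t0 <= b ->
  {for t0, continuous h} -> (forall t, h t <= g t) ->
  ((h t0)%:E <= ess_sup (mrestr (@lebesgue_measure R) (measurable_itv `]a, b[))
     (fun t => (g t)%:E))%E.
Proof.
move=> ab /andP[at0 t0b] ch hg; rewrite leNgt; apply/negP => lt.
set mu := mrestr _ _ in lt.
have := ess_sup_ge mu (fun t => (g t)%:E); set s := ess_sup _ _ in lt *.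
have [r sr rh] : exists2 r : R, (s <= r%:E)%E & r < h t0.
  move: lt; case: s => [r| |] //= lt; first by exists r; rewrite // -lte_fin.
  by exists (h t0 - 1); rewrite ?leNye // gtrBl.
case=> N [mN N0 sN].
have /nbhs_ballP[e /= e0 be] : \forall t \near t0, r < h t.
  by move: ch => /cvgr_gt; apply.
pose l := Num.max a (t0 - e); pose u := Num.min b (t0 + e).
have lu : l < u.
  rewrite /l /u gt_max !lt_min ab /=; apply/andP; split; first lra.
  by apply/andP; split; lra.
have sub : `]l, u[ `<=` N `&` `]a, b[.
  move=> t /=; rewrite !in_itv /= gt_max lt_min => /andP[/andP[at_ tl] /andP[tb tu]].
  split; last by rewrite at_ tb.
  apply: sN => /= gs.
  have : r < h t by apply: be; rewrite /ball /= distrC ltr_norml; apply/andP; split; lra.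
  move: gs => /(fun h => le_trans h sr); rewrite lee_fin => gr.
  by rewrite ltNge (le_trans (hg t) gr).
have : (lebesgue_measure `]l, u[%classic <= 0)%E.
  rewrite -[leRHS]N0; apply: le_measure => //; rewrite inE //.
  exact: measurableI.
rewrite lebesgue_measure_itv /= lte_fin lu EFinN -EFinD lee_fin leNgt.
by rewrite subr_gt0 lu.
Qed.

Variable d : nat.
Implicit Types (A : 'M[C]_d) (x : 'cV[C]_d).

Lemma mxnorm2_le A (K : R) : (forall x, norm2 (A *m x) <= K * norm2 x) -> 0 <= K ->
  mxnorm2 A <= K.
Proof.
move=> AK K0; apply: ge_sup.
  by exists (norm2 (A *m 0)), 0 => //=; rewrite norm20.
by move=> _ [x /= x1 <-]; rewrite (le_trans (AK x)) // ler_piMr.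
Qed.

(** The bound K ensures that the supremum defining the norm is taken over a
bounded set; without it the supremum would be a default value. *)
Lemma norm2_le_mxnorm2 A (K : R) x : (forall x, norm2 (A *m x) <= K * norm2 x) ->
  0 <= K -> norm2 x <= 1 -> norm2 (A *m x) <= mxnorm2 A.
Proof.
move=> AK K0 x1; apply: ub_le_sup; last by exists x.
by exists K => _ [y /= y1 <-]; rewrite (le_trans (AK y)) // ler_piMr.
Qed.

Lemma rayleigh_le_mxnorm2 A (K r : R) x :
  (forall x, norm2 (A *m x) <= K * norm2 x) -> 0 <= K -> x != 0 ->
  dot x (A *m x) = (r * norm2 x ^+ 2)%:C%C -> r <= mxnorm2 A.
Proof.
move=> AK K0 x0 rE.
have nx0 : 0 < norm2 x by rewrite lt_def norm2_eq0 x0 norm2_ge0.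
pose k := (norm2 x)^-1.
have normck : Normc.normc k%:C%C = k.
  by apply: complexI; rewrite normcC ger0_norm // lecR invr_ge0 ltW.
have n1 : norm2 (k%:C%C *: x) <= 1 by rewrite norm2Z normck mulVf // gt_eqF.
apply: le_trans (norm2_le_mxnorm2 AK K0 n1).
rewrite -scalemxAr norm2Z normck mulrC ler_pdivlMr // -(ler_pM2r nx0).
rewrite -mulrA -expr2.
have := normc_dot_le x (A *m x); rewrite rE [leRHS]mulrC => H.
apply: le_trans H; exact: le_Re_normc (_%:C%C).
Qed.

End Norms.

(** * Trigonometric symbols of degree one *)

Section Expi.
Variable R : realType.
Implicit Types t : R.

Lemma conj_expi t : (expi t)^*%R = expi (- t).
Proof. by rewrite /expi cosN sinN. Qed.

Lemma normc_expi t : Normc.normc (expi t) = 1.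
Proof. by rewrite /= cos2Dsin2 sqrtr1. Qed.

Lemma expiN_add t : expi (- t) + expi t = (2 * cos t)%:C%C.
Proof.
rewrite /expi cosN sinN; apply/eqP.
by rewrite eq_complex /= addNr eqxx andbT -mulr2n mulr_natl.
Qed.

(** Three angles suffice: adding the equations at 0 and pi isolates a, and the
equation at pi / 2 separates b from c. *)
Lemma trig_poly1_eq0 (a b c : R[i]) :
  (forall t, a + expi (- t) * b + expi t * c = 0) -> [/\ a = 0, b = 0 & c = 0].
Proof.
move=> h.
have := h 0; rewrite oppr0 [expi 0](_ : _ = 1) ?mul1r => [h0|]; last first.
  by rewrite /expi cos0 sin0.
have := h pi; rewrite /expi cosN sinN cospi sinpi oppr0.
have -> : Complex (-1) 0 = -1 :> R[i] by rewrite complexr0 rmorphN1.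
move=> h1.
have := h (pi / 2); rewrite /expi cosN sinN cos_pihalf sin_pihalf.
set i := Complex 0 1; have -> : Complex 0 (-1) = - i by rewrite /i; simpc.
move=> h2.
have i0 : i != 0 by rewrite eq_complex /= oner_eq0 andbF.
have a0 : a = 0.
  have : a *+ 2 = (a + b + c) + (a + -1 * b + -1 * c) by ring.
  by rewrite h0 h1 addr0 => /eqP; rewrite mulrn_eq0 => /eqP.
have bc : b = - c by apply/eqP; rewrite -addr_eq0 -h0 a0 add0r.
have c0 : c = 0.
  have : i * c *+ 2 = 0 by rewrite -[RHS]h2 a0 bc; ring.
  by move/eqP; rewrite mulrn_eq0 /= mulf_eq0 (negPf i0) => /eqP.
by rewrite bc c0 oppr0.
Qed.

End Expi.

Section RankTwo.
Variables (R : realType) (d : nat) (w q : 'cV[R[i]]_d) (c : R).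
Hypothesis dot_qw : dot q w = c%:C%C.

Definition rank2_symbol t : 'M[R[i]]_d :=
  expi (- t) *: (w *m q^t*) + expi t *: (q *m w^t*).

(* m is the largest eigenvalue of the rank-two matrix over all angles. *)
Let W := norm2 w.
Let Q := norm2 q.
Let m := `|c| + W * Q.

Let W0 : 0 <= W. Proof. exact: norm2_ge0. Qed.
Let Q0 : 0 <= Q. Proof. exact: norm2_ge0. Qed.
Let m0 : 0 <= m. Proof. by rewrite addr_ge0 ?mulr_ge0. Qed.

(** The phase e^(-it) is absorbed in the first vector, which changes neither its
length nor the modulus of its product with q. *)
Lemma norm2_symbol_le t x :
  norm2 ((1%:M + rank2_symbol t) *m x) <= (1 + m) * norm2 x.
Proof.
rewrite mulmxDl mul1mx mulrDl mul1r (le_trans (norm2D _ _)) // lerD2l.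
pose p := expi (- t) *: w.
have -> : rank2_symbol t *m x = dot q x *: p + dot p x *: q.
  rewrite mulmxDl -!scalemxAl !rank1E /p scalerA mulrC -scalerA; congr (_ + _).
  by rewrite scalerA dotZl conj_expi opprK.
apply: le_trans (norm2_hermitian_rank2_le p q x) _.
rewrite /p norm2Z dotZr Normc.normcM normc_expi !mul1r dot_qw addrC.
suff -> : Normc.normc c%:C%C = `|c| by [].
by rewrite /= expr0n addr0 sqrtr_sqr.
Qed.

(** For x = ||q|| w + s ||w|| q the products q^* x = s ||q|| m and w^* x = ||w|| m
are real, so the two conjugate phases add up to 2 cos t. If w or q is zero then
m = 0 and the matrix is the identity, for which any nonzero vector will do. *)
Lemma rayleigh_symbol s : (0 < d)%N -> s ^+ 2 = 1 -> s * c = `|c| ->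
  exists2 x, x != 0 & forall t, dot x ((1%:M + rank2_symbol t) *m x) =
    ((1 + m * (s * cos t)) * norm2 x ^+ 2)%:C%C.
Proof.
move=> d0 s2 sc.
have dotE x t : dot x ((1%:M + rank2_symbol t) *m x) =
    dot x x + expi (- t) * (dot q x * (dot w x)^*%R)
      + expi t * (dot w x * (dot q x)^*%R).
  rewrite mulmxDl mul1mx mulmxDl -!scalemxAl !rank1E !dotDr !dotZr -!dotC.
  by rewrite addrA.
have [P0|P0] := eqVneq (W * Q) 0.
  have cs : `|c| <= 0.
    have := normc_dot_le q w; rewrite dot_qw mulrC -/W -/Q P0 /=.
    by rewrite expr0n addr0 sqrtr_sqr.
  have mE : m = 0 by apply/eqP; rewrite eq_le m0 andbT /m P0 addr0.
  exists (const_mx 1) => [|t].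
    apply/eqP => /colP/(_ (Ordinal d0)); rewrite !mxE => /eqP.
    by rewrite oner_eq0.
  rewrite dotE mE mul0r addr0 mul1r dotxx.
  move: P0 => /eqP; rewrite mulf_eq0 !norm2_eq0 => /orP[] /eqP ->;
  by rewrite dot0l conjC0 ?(mul0r, mulr0) !addr0.
have c_s : c = s * `|c| by rewrite -sc mulrA -expr2 s2 mul1r.
pose x := Q%:C%C *: w + (s * W)%:C%C *: q.
have qx : dot q x = (s * Q * m)%:C%C.
  rewrite dotDr !dotZr dot_qw dotxx -!realcM -realcD; congr (_%:C%C).
  by rewrite {1}c_s /m -/Q; ring.
have cr (r : R) : (r%:C%C)^*%R = r%:C%C :> R[i] by exact: conjc_real.
have wx : dot w x = (W * m)%:C%C.
  rewrite dotDr !dotZr [dot w q]dotC dot_qw dotxx.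
  rewrite cr -!realcM -realcD; congr (_%:C%C).
  rewrite -/W {1}c_s /m.
  have -> : s * W * (s * `|c|) = s ^+ 2 * W * `|c| by ring.
  by rewrite s2; ring.
have nx : norm2 x ^+ 2 = 2 * (W * Q) * m.
  apply: complexI; rewrite -dotxx {1}/x dotDl !dotZl !cr wx qx -!realcM -realcD.
  congr (_%:C%C).
  have -> : s * W * (s * Q * m) = s ^+ 2 * (W * Q * m) by ring.
  by rewrite s2; ring.
have m_gt0 : 0 < m.
  by rewrite /m ltr_wpDl // lt_def P0 mulr_ge0.
exists x => [|t].
  by rewrite -norm2_eq0 -sqrf_eq0 nx -mulrA mulf_neq0 ?pnatr_eq0 // mulf_neq0 // gt_eqF.
rewrite dotE qx wx !cr dotxx nx [(W * m)%:C%C * _]mulrC -addrA -mulrDl expiN_add.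
by rewrite -!realcM -realcD; congr (_%:C%C); ring.
Qed.

End RankTwo.

(** Subtracting from f its adjoint gives a vanishing trigonometric polynomial, so
the coefficients of f are matched with the adjoints of the opposite ones. The
mean coefficient is positive semidefinite as the average of f 0 and f pi. *)
Lemma symbol_coefs (R : realType) (d : nat) (f : R -> 'M[R[i]]_d)
    (F0 X Y : 'M[R[i]]_d) :
  (forall t, psdmx (f t)) ->
  (forall t, f t = F0 + expi (- t) *: X + expi t *: Y) ->
  psdmx F0 /\ X^t* = Y.
Proof.
move=> pf fE.
have H i j : [/\ (F0^t* - F0) i j = 0, (Y^t* - X) i j = 0 & (X^t* - Y) i j = 0].
  apply: trig_poly1_eq0 => t.
  have : ((f t)^t* - f t) i j = 0 by rewrite psdmx_adj // subrr mxE.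
  rewrite fE !adjmxD !adjmxZ !conj_expi opprK => <-.
  rewrite !mxE; ring.
have hF : F0^t* = F0.
  by apply/matrixP => i j; apply/eqP; rewrite -subr_eq0; have [<- _ _] := H i j; rewrite !mxE.
have XY : X^t* = Y.
  by apply/matrixP => i j; apply/eqP; rewrite -subr_eq0; have [_ _ <-] := H i j; rewrite !mxE.
split=> //; apply: psdmxP => // x.
have -> : F0 = 2^-1 *: (f 0 + f pi).
  rewrite !fE /expi oppr0 cosN sinN cos0 sin0 cospi sinpi oppr0.
  have -> : Complex (-1) 0 = -1 :> R[i] by rewrite complexr0 rmorphN1.
  have -> : Complex 1 0 = 1 :> R[i] by [].
  by apply/matrixP => i j; rewrite !mxE; field.
rewrite -scalemxAl dotZr mulmxDl dotDr mulr_ge0 ?invr_ge0 ?ler0n //.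
by rewrite addr_ge0 // psdmx_dot_ge0.
Qed.

(** * The maximum over the angle *)

(** The radicand is c^2 cos^2 t + (K^2 - c^2), nonnegative because |c| <= K, so
the complex square root is the real one. Both summands are largest when cos t is
the sign s of c. *)
Lemma is_max_rank2_eigenvalue (R : realType) (c K s t0 : R) : `|c| <= K ->
  s * c = `|c| -> cos t0 = s -> s ^+ 2 = 1 ->
  is_max (fun t => c%:C%C * (cos t)%:C%C
      + sqrtC (c%:C%C ^+ 2 * ((cos t)%:C%C ^+ 2 - 1) + K%:C%C ^+ 2)) (`|c| + K).
Proof.
move=> cK sc ct s2; have K0 : 0 <= K := le_trans (normr_ge0 c) cK.
have c2K : c ^+ 2 <= K ^+ 2 by rewrite -real_normK ?num_real // ler_pXn2r.
have hE t : c%:C%C * (cos t)%:C%C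
      + sqrtC (c%:C%C ^+ 2 * ((cos t)%:C%C ^+ 2 - 1) + K%:C%C ^+ 2) =
    (c * cos t + Num.sqrt (c ^+ 2 * (cos t ^+ 2 - 1) + K ^+ 2))%:C%C :> R[i].
  rewrite realcD realcM -sqrtC_real.
    by rewrite realcD !realcX realcM realcB !realcX.
  have : 0 <= c ^+ 2 * cos t ^+ 2 by rewrite mulr_ge0 ?sqr_ge0.
  lra.
split=> [|t].
  exists t0; rewrite hE ct s2 subrr mulr0 add0r sqrtr_sqr ger0_norm //.
  by rewrite mulrC sc.
rewrite hE lecR lerD //.
  by rewrite (le_trans (ler_norm _)) // normrM ler_piMr // ler_norml cos_geN1 cos_le1.
rewrite -[leRHS](ger0_norm K0) -sqrtr_sqr ler_wsqrtr // gerDr.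
by rewrite mulr_ge0_le0 ?sqr_ge0 // subr_le0 -{2}(cos2Dsin2 t) lerDl sqr_ge0.
Qed.

Theorem theorem4 (R : realType) (d n : nat) (hd : (0 < d)%N) (hn : (0 < n)%N)
  (f : R -> 'M[R[i]]_d)
  (A : 'M[R[i]]_(n * d)) (hA : A = block_circulant n f)
  (hpsd : forall t : R, psdmx (f t))
  (hf : forall t : R,
     f t = fourier_coef f 0 + expi (- t) *: fourier_coef f (-1)
                            + expi t *: fourier_coef f 1)
  (u v : 'cV[R[i]]_d)
  (hfm1 : fourier_coef f (-1) = u *m v^T)
  (hf1 : fourier_coef f 1 = (fourier_coef f (-1))^T)
  (hf0sym : (fourier_coef f 0)^T = fourier_coef f 0)
  (hf0unit : fourier_coef f 0 \in unitmx) :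
  let B := inv_sqrtmx (fourier_coef f 0) in
  let w := B *m u in
  let z := B *m v in
  let zw := (z^T *m w) 0 0 in
  exists2 m : R,
    is_max (fun t : R =>
      zw * (cos t)%:C%C
      + sqrtC (zw ^+ 2 * ((cos t)%:C%C ^+ 2 - 1)
               + (norm2 w)%:C%C ^+ 2 * (norm2 z)%:C%C ^+ 2)) m
    & norm_oo (fun t : R => B *m f t *m B) = (1 + m)%:E.
Proof.
move=> B w z zw.
have [pF0 XY] := symbol_coefs hpsd hf.
have [hB tB BFB] := inv_sqrtmxP pF0 hf0unit hf0sym.
pose q := map_mx Num.conj z.
have qz : q^t* = z^T by rewrite /q -map_trmx map_mxCK.
have wz : w *m q^t* = B *m fourier_coef f (-1) *m B.
  by rewrite qz hfm1 /w /z trmx_mul tB !mulmxA.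
have zwq : q *m w^t* = B *m fourier_coef f 1 *m B.
  by rewrite -XY -(trmxCK q) -adjmxM wz !adjmxM hB mulmxA.
(* Comparing this with the definition of q shows that w z^T is real. *)
have zwT : q *m w^t* = z *m w^T.
  by rewrite zwq hf1 -[z]trmxK -qz -trmx_mul wz !trmx_mul tB mulmxA.
have fE t : B *m f t *m B = 1%:M + rank2_symbol w q t.
  rewrite hf !mulmxDr !mulmxDl BFB -!scalemxAr -!scalemxAl -wz -zwq.
  by rewrite /rank2_symbol addrA.
have qw : dot q w = zw by rewrite /dot qz.
(* z^T w is the trace of the real matrix w z^T. *)
have zwR : zw^*%R = zw.
  rewrite -{1}qw -dotC /dot -trace_mx11 mxtrace_mulC zwT mxtrace_mulC.
  by rewrite -mxtrace_tr trmx_mul trmxK trace_mx11.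
pose c := complex.Re zw.
have cE : zw = c%:C%C by rewrite RRe_real //; apply/CrealP.
have qnorm : norm2 q = norm2 z by exact: norm2_conj.
pose s : R := if 0 <= c then 1 else -1.
pose t0 : R := if 0 <= c then 0 else pi.
have ct0 : cos t0 = s by rewrite /t0 /s; case: ifP => _; rewrite ?cos0 ?cospi.
have s2 : s ^+ 2 = 1 by rewrite /s; case: ifP => _; rewrite ?sqrrN expr1n.
have sc : s * c = `|c|.
  rewrite /s; case: ifPn => [c0|]; first by rewrite mul1r ger0_norm.
  by rewrite -ltNge => c0; rewrite mulN1r ltr0_norm.
rewrite cE in qw *.
have cK : `|c| <= norm2 w * norm2 z.
  have := normc_dot_le q w; rewrite qw qnorm mulrC /=.
  by rewrite expr0n addr0 sqrtr_sqr.
exists (`|c| + norm2 w * norm2 z).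
  rewrite -exprMn -realcM; exact: (is_max_rank2_eigenvalue (t0 := t0) cK sc).
have normle t : forall x, norm2 (B *m f t *m B *m x)
    <= (1 + (`|c| + norm2 w * norm2 z)) * norm2 x.
  by move=> x; rewrite fE -qnorm; exact: norm2_symbol_le.
have m0 : 0 <= 1 + (`|c| + norm2 w * norm2 z).
  by rewrite !addr_ge0 ?mulr_ge0 ?norm2_ge0.
apply/eqP; rewrite eq_le; apply/andP; split.
  by apply: ess_sup_ler => t; rewrite lee_fin; exact: mxnorm2_le.
have [x x0 xE] := rayleigh_symbol qw hd s2 sc.
rewrite qnorm in xE.
pose h t := 1 + (`|c| + norm2 w * norm2 z) * (s * cos t).
have -> : 1 + (`|c| + norm2 w * norm2 z) = h t0.
  by rewrite /h ct0 -expr2 s2 mulr1.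
(* The minorant is the Rayleigh quotient at the fixed vector x. *)
apply: ess_sup_itv_ge.
- by have := pi_gt0 R; lra.
- by have := pi_gt0 R; rewrite /t0; case: ifP => _ p0; apply/andP; split; lra.
- apply: cvgD; first exact: cvg_cst.
  by apply: cvgM; [exact: cvg_cst | apply: cvgM; [exact: cvg_cst | exact: continuous_cos]].
- move=> t; apply: (rayleigh_le_mxnorm2 (normle t) m0 x0).
  by rewrite fE xE.
Qed.
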